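(* For the $q$-Onsager algebra $\mathcal O_q$ with generators $A,B$, and with $S$, $S'$ formed using the element $A$ of $\mathcal O_q$, the following (i)--(iv) hold: (i) $A\in\mathcal O_q^{(0)}$ and $B\in\mathcal O_q^{(1)}$; (ii) the algebra $\mathcal O_q$ is $A$-standard; (iii) $S$ sends $$A\mapsto A,\qquad B\mapsto B+\frac{qA^2B-(q+q^{-1})ABA+q^{-1}BA^2}{(q-q^{-1})(q^2-q^{-2})},$$ and $S'$ sends $$A\mapsto A,\qquad B\mapsto B+\frac{q^{-1}A^2B-(q+q^{-1})ABA+qBA^2}{(q-q^{-1})(q^2-q^{-2})};$$ (iv) $S=L$ and $S'=L^{-1}$, where $L$ is the Lusztig automorphism of $\mathcal O_q$.
   Context: Let $\mathbb F$ be a field and fix $0\neq q\in\mathbb F$ that is not a root of unity. Algebras are associative with $1$. Write $[n]_q=(q^n-q^{-n})/(q-q^{-1})$. The $q$-Onsager algebra $\mathcal O_q$ is the $\mathbb F$-algebra with generators $A,B$ and relations $$A^3B-[3]_qA^2BA+[3]_qABA^2-BA^3=(q^2-q^{-2})^2(BA-AB),$$ $$B^3A-[3]_qB^2AB+[3]_qBAB^2-AB^3=(q^2-q^{-2})^2(AB-BA).$$ The Lusztig automorphism $L$ is the $\mathbb F$-algebra automorphism of $\mathcal O_q$ (found by Baseilhac and Kolb) that satisfies $$L(A)=A,\qquad L(B)=B+\frac{qA^2B-(q+q^{-1})ABA+q^{-1}BA^2}{(q-q^{-1})(q^2-q^{-2})},$$ $$L^{-1}(A)=A,\qquad L^{-1}(B)=B+\frac{q^{-1}A^2B-(q+q^{-1})ABA+qBA^2}{(q-q^{-1})(q^2-q^{-2})}.$$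 For an $\mathbb F$-algebra $\mathcal A$, an element $A\in\mathcal A$ and $r\in\mathbb Z$, $\mathrm{ad}_rA:\mathcal A\to\mathcal A$ is the $\mathbb F$-linear map $X\mapsto q^rAX-q^{-r}XA$, and $\mathrm{ad}\,A=\mathrm{ad}_0A$. These maps mutually commute; products of maps are compositions and $I$ is the identity map. Define $$\mathrm{bad}_0A=\frac{\mathrm{ad}\,A}{q-q^{-1}},\qquad \mathrm{bad}_nA=\frac{(q^{2n}-q^{-2n})^2I+(\mathrm{ad}_nA)(\mathrm{ad}_{-n}A)}{(q^{2n}-q^{-2n})(q^{2n+1}-q^{-2n-1})}\quad(n\ge1),$$ $$(\mathrm{bad}\,A)_n=\prod_{i=0}^{n-1}\mathrm{bad}_iA\quad(n\ge0),\qquad(\mathrm{bad}\,A)_0=I,$$ and $S_0=S'_0=I$, $$S_n=\frac{(\mathrm{bad}\,A)_n\,\mathrm{ad}_nA}{q^{2n}-q^{-2n}},\qquad S'_n=\frac{(\mathrm{bad}\,A)_n\,\mathrm{ad}_{-n}A}{q^{2n}-q^{-2n}}\quad(n\ge1),$$ with formal sums $S=\sum_{n\ge0}S_n$, $S'=\sum_{n\ge0}S'_n$. For $n\ge0$, $\mathcal A^{(n)}=\{X\in\mathcal A:(\mathrm{bad}\,A)_{n+1}(X)=0\}$; on $\mathcal A^{(n)}$ one has $S=\sum_{r=0}^nS_r$ and $S'=\sum_{r=0}^nS'_r$. An element $X\in\mathcal A$ is $A$-standard if $(\mathrm{bad}\,A)_n(X)=0$ for some positive integer $n$; the algebra $\mathcal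 A$ is $A$-standard if each of its elements is $A$-standard. *)

(* Defs.v *)
From HB Require Import structures.
From mathcomp Require Import all_boot all_order all_algebra generic_quotient.
From mathcomp Require Import boolp classical_sets cardinality fsbigop.

Set Implicit Arguments.
Unset Strict Implicit.
Unset Printing Implicit Defensive.

Import GRing.Theory.
Local Open Scope ring_scope.
Local Open Scope quotient_scope.

Definition not_root_of_unity (F : fieldType) (q : F) : Prop :=
  forall n : nat, (0 < n)%N -> q ^+ n != 1.

Definition qnum (F : fieldType) (q : F) (n : nat) : F :=
  (q ^+ n - q ^- n) / (q - q^-1).

(* The q-Onsager algebra by generators and relations: formal algebra
   expressions in two letters, modulo the least congruence containing the
   axioms of associative unital F-algebras and the two defining relations. *)
Inductive oq_term (F : Type) : Type :=
  | TA
  | TB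
  | TZero
  | TOne
  | TAdd of oq_term F & oq_term F
  | TMul of oq_term F & oq_term F
  | TScale of F & oq_term F.
Arguments TA {F}.
Arguments TB {F}.
Arguments TZero {F}.
Arguments TOne {F}.

HB.instance Definition _ (F : Type) := gen_eqMixin (oq_term F).
HB.instance Definition _ (F : Type) := gen_choiceMixin (oq_term F).

Declare Scope oq_term_scope.
Delimit Scope oq_term_scope with oqt.
Bind Scope oq_term_scope with oq_term.
Notation "t + u" := (TAdd t u) : oq_term_scope.
Notation "t * u" := (TMul t u) : oq_term_scope.
Notation "c *: t" := (TScale c%R t) : oq_term_scope.
Notation "t - u" := (TAdd t (TScale (-1)%R u)) : oq_term_scope.

Inductive oq_cong (F : fieldType) (q : F) : oq_term F -> oq_term F -> Prop :=
  | cong_refl t : oq_cong q t t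
  | cong_sym t u : oq_cong q t u -> oq_cong q u t
  | cong_trans t u v : oq_cong q t u -> oq_cong q u v -> oq_cong q t v
  | cong_add t t' u u' :
      oq_cong q t t' -> oq_cong q u u' -> oq_cong q (t + u) (t' + u')
  | cong_mul t t' u u' :
      oq_cong q t t' -> oq_cong q u u' -> oq_cong q (t * u) (t' * u')
  | cong_scale c t t' : oq_cong q t t' -> oq_cong q (c *: t) (c *: t')
  | cong_addA t u v : oq_cong q (t + (u + v)) (t + u + v)
  | cong_addC t u : oq_cong q (t + u) (u + t)
  | cong_add0 t : oq_cong q (TZero + t) t
  | cong_addN t : oq_cong q (-1 *: t + t) TZero
  | cong_mulA t u v : oq_cong q (t * (u * v)) (t * u * v)
  | cong_mul1l t : oq_cong q (TOne * t) t
  | cong_mul1r t : oq_cong q (t * TOne) t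
  | cong_mulDl t u v : oq_cong q ((t + u) * v) (t * v + u * v)
  | cong_mulDr t u v : oq_cong q (t * (u + v)) (t * u + t * v)
  | cong_scaleA a b t : oq_cong q (a *: (b *: t)) ((a * b) *: t)
  | cong_scale1 t : oq_cong q (1 *: t) t
  | cong_scaleDr c t u : oq_cong q (c *: (t + u)) (c *: t + c *: u)
  | cong_scaleDl a b t : oq_cong q ((a + b) *: t) (a *: t + b *: t)
  | cong_scaleAl c t u : oq_cong q (c *: (t * u)) ((c *: t) * u)
  | cong_scaleAr c t u : oq_cong q (c *: (t * u)) (t * (c *: u))
  | cong_rel1 : oq_cong q
      (TA * TA * TA * TB - qnum q 3 *: (TA * TA * TB * TA)
       + qnum q 3 *: (TA * TB * TA * TA) - TB * TA * TA * TA)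
      ((q ^+ 2 - q ^- 2) ^+ 2 *: (TB * TA - TA * TB))
  | cong_rel2 : oq_cong q
      (TB * TB * TB * TA - qnum q 3 *: (TB * TB * TA * TB)
       + qnum q 3 *: (TB * TA * TB * TB) - TA * TB * TB * TB)
      ((q ^+ 2 - q ^- 2) ^+ 2 *: (TA * TB - TB * TA)).

Section Quotient.
Variables (F : fieldType) (q : F).

Definition oq_equiv (t u : oq_term F) : bool := `[< oq_cong q t u >].

Lemma oq_equiv_refl : reflexive oq_equiv.
Proof. by move=> t; apply/asboolP/cong_refl. Qed.

Lemma oq_equiv_sym : symmetric oq_equiv.
Proof. by move=> t u; apply/asboolP/asboolP => /cong_sym. Qed.

Lemma oq_equiv_trans : transitive oq_equiv.
Proof.
by move=> t u v /asboolP h /asboolP h'; apply/asboolP; apply: cong_trans h'.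
Qed.

Canonical oq_equiv_rel := EquivRel oq_equiv
  oq_equiv_refl oq_equiv_sym oq_equiv_trans.

Definition qOnsager : Type := {eq_quot oq_equiv_rel}.
HB.instance Definition _ := Choice.copy qOnsager {eq_quot oq_equiv_rel}.

Definition oq_class (t : oq_term F) : qOnsager := \pi_{eq_quot oq_equiv_rel} t.
Definition oq_repr (x : qOnsager) : oq_term F :=
  repr (x : {eq_quot oq_equiv_rel}).

Lemma oq_reprK : cancel oq_repr oq_class.
Proof. by move=> x; rewrite /oq_class /oq_repr reprK. Qed.

Lemma oq_classP t u : oq_class t = oq_class u <-> oq_cong q t u.
Proof.
split=> [h|h].
  by apply/asboolP; have /eqmodP := h.
by apply/eqmodP/asboolP.
Qed.

Lemma oq_classK t : oq_cong q (oq_repr (oq_class t)) t.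
Proof. by apply/oq_classP; rewrite oq_reprK. Qed.

Definition oqA : qOnsager := oq_class TA.
Definition oqB : qOnsager := oq_class TB.

Definition oq_zero : qOnsager := oq_class TZero.
Definition oq_one : qOnsager := oq_class TOne.
Definition oq_add (x y : qOnsager) := oq_class (oq_repr x + oq_repr y).
Definition oq_mul (x y : qOnsager) := oq_class (oq_repr x * oq_repr y).
Definition oq_scale (c : F) (x : qOnsager) := oq_class (c *: oq_repr x).

Lemma oq_addE t u : oq_add (oq_class t) (oq_class u) = oq_class (t + u).
Proof. by apply/oq_classP/cong_add; apply: oq_classK. Qed.

Lemma oq_mulE t u : oq_mul (oq_class t) (oq_class u) = oq_class (t * u).
Proof. by apply/oq_classP/cong_mul; apply: oq_classK. Qed.

Lemma oq_scaleE c t : oq_scale c (oq_class t) = oq_class (c *: t).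
Proof. by apply/oq_classP/cong_scale; apply: oq_classK. Qed.

Lemma oq_ind (P : qOnsager -> Prop) : (forall t, P (oq_class t)) -> forall x, P x.
Proof. by move=> h x; rewrite -[x]oq_reprK. Qed.

Let oqE := (oq_addE, oq_mulE, oq_scaleE).

Fact oq_addA : associative oq_add.
Proof.
by elim/oq_ind=> t; elim/oq_ind=> u; elim/oq_ind=> v;
   rewrite !oqE; apply/oq_classP; constructor.
Qed.
Fact oq_addC : commutative oq_add.
Proof.
by elim/oq_ind=> t; elim/oq_ind=> u; rewrite !oqE; apply/oq_classP;
   apply: cong_addC.
Qed.
Fact oq_add0 : left_id oq_zero oq_add.
Proof. by elim/oq_ind=> t; rewrite !oqE; apply/oq_classP; constructor. Qed.
Fact oq_addN : left_inverse oq_zero (oq_scale (-1)) oq_add.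
Proof. by elim/oq_ind=> t; rewrite !oqE; apply/oq_classP; constructor. Qed.

HB.instance Definition _ :=
  GRing.isZmodule.Build qOnsager oq_addA oq_addC oq_add0 oq_addN.

Fact oq_addrE t u : oq_class t + oq_class u = oq_class (t + u)%oqt.
Proof. exact: oq_addE. Qed.

Fact oq_mulA : associative oq_mul.
Proof.
by elim/oq_ind=> t; elim/oq_ind=> u; elim/oq_ind=> v;
   rewrite !oqE; apply/oq_classP; constructor.
Qed.
Fact oq_mul1l : left_id oq_one oq_mul.
Proof. by elim/oq_ind=> t; rewrite !oqE; apply/oq_classP; constructor. Qed.
Fact oq_mul1r : right_id oq_one oq_mul.
Proof. by elim/oq_ind=> t; rewrite !oqE; apply/oq_classP; constructor. Qed.
Fact oq_mulDl : left_distributive oq_mul +%R.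
Proof.
by elim/oq_ind=> t; elim/oq_ind=> u; elim/oq_ind=> v;
   rewrite /GRing.add /= !oqE; apply/oq_classP; constructor.
Qed.
Fact oq_mulDr : right_distributive oq_mul +%R.
Proof.
by elim/oq_ind=> t; elim/oq_ind=> u; elim/oq_ind=> v;
   rewrite /GRing.add /= !oqE; apply/oq_classP; constructor.
Qed.

Fixpoint oq_eval (C : algType F) (a b : C) (t : oq_term F) : C :=
  match t with
  | TA => a
  | TB => b
  | TZero => 0
  | TOne => 1
  | TAdd t u => oq_eval a b t + oq_eval a b u
  | TMul t u => oq_eval a b t * oq_eval a b u
  | TScale c t => c *: oq_eval a b t
  end.

Definition oq_relations (C : algType F) (a b : C) : Prop :=
  a ^+ 3 * b - qnum q 3 *: (a ^+ 2 * b * a)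
    + qnum q 3 *: (a * b * a ^+ 2) - b * a ^+ 3
    = (q ^+ 2 - q ^- 2) ^+ 2 *: (b * a - a * b) /\
  b ^+ 3 * a - qnum q 3 *: (b ^+ 2 * a * b)
    + qnum q 3 *: (b * a * b ^+ 2) - a * b ^+ 3
    = (q ^+ 2 - q ^- 2) ^+ 2 *: (a * b - b * a).

Lemma oq_eval_cong (C : algType F) (a b : C) t u :
  oq_relations a b -> oq_cong q t u -> oq_eval a b t = oq_eval a b u.
Proof.
move=> [r1 r2]; elim=> /=.
- by [].
- by move=> ? ? _ ->.
- by move=> ? ? ? _ -> _ ->.
- by move=> ? ? ? ? _ -> _ ->.
- by move=> ? ? ? ? _ -> _ ->.
- by move=> ? ? ? _ ->.
- by move=> *; rewrite addrA.
- by move=> *; rewrite addrC.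
- by move=> *; rewrite add0r.
- by move=> *; rewrite scaleN1r addNr.
- by move=> *; rewrite mulrA.
- by move=> *; rewrite mul1r.
- by move=> *; rewrite mulr1.
- by move=> *; rewrite mulrDl.
- by move=> *; rewrite mulrDr.
- by move=> *; rewrite scalerA.
- by move=> *; rewrite scale1r.
- by move=> *; rewrite scalerDr.
- by move=> *; rewrite scalerDl.
- by move=> *; rewrite scalerAl.
- by move=> *; rewrite scalerAr.
- by rewrite !scaleN1r -r1 !exprS expr0 !mulr1 !mulrA.
- by rewrite !scaleN1r -r2 !exprS expr0 !mulr1 !mulrA.
Qed.

Fact oq_one_neq0 : oq_one != 0.
Proof.
apply/eqP => /oq_classP h.
have r0 : @oq_relations F^o 0 0.
  by split; rewrite !(exprS, mul0r, mulr0, scaler0, subrr, addr0).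
by have /eqP := oq_eval_cong r0 h; rewrite oner_eq0.
Qed.

HB.instance Definition _ := GRing.Zmodule_isNzRing.Build qOnsager
  oq_mulA oq_mul1l oq_mul1r oq_mulDl oq_mulDr oq_one_neq0.

Fact oq_scaleA a b x : oq_scale a (oq_scale b x) = oq_scale (a * b) x.
Proof. by elim/oq_ind: x => t; rewrite !oqE; apply/oq_classP; constructor. Qed.
Fact oq_scale1 : left_id 1 oq_scale.
Proof. by elim/oq_ind=> t; rewrite !oqE; apply/oq_classP; constructor. Qed.
Fact oq_scaleDr : right_distributive oq_scale +%R.
Proof.
by move=> c; elim/oq_ind=> t; elim/oq_ind=> u;
   rewrite /GRing.add /= !oqE; apply/oq_classP; constructor.
Qed.
Fact oq_scaleDl x : {morph oq_scale^~ x : a b / a + b}.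
Proof.
move=> a b; elim/oq_ind: x => t.
by rewrite !oqE oq_addrE; apply/oq_classP/cong_scaleDl.
Qed.

HB.instance Definition _ := GRing.Zmodule_isLmodule.Build F qOnsager
  oq_scaleA oq_scale1 oq_scaleDr oq_scaleDl.

Fact oq_scaleAl (c : F) (x y : qOnsager) : c *: (x * y) = (c *: x) * y.
Proof.
elim/oq_ind: x => t; elim/oq_ind: y => u.
by rewrite /GRing.mul /GRing.scale /= !oqE; apply/oq_classP/cong_scaleAl.
Qed.
HB.instance Definition _ := GRing.Lmodule_isLalgebra.Build F qOnsager oq_scaleAl.

Fact oq_scaleAr (c : F) (x y : qOnsager) : c *: (x * y) = x * (c *: y).
Proof.
elim/oq_ind: x => t; elim/oq_ind: y => u.
by rewrite /GRing.mul /GRing.scale /= !oqE; apply/oq_classP/cong_scaleAr.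
Qed.
HB.instance Definition _ := GRing.Lalgebra_isAlgebra.Build F qOnsager oq_scaleAr.

Lemma oq_eval_class t : oq_eval oqA oqB t = oq_class t.
Proof.
elim: t => //= [t -> u ->|t -> u ->|c t ->].
- by rewrite [LHS]oq_addE.
- by rewrite [LHS]oq_mulE.
- by rewrite [LHS]oq_scaleE.
Qed.

Lemma oqP : oq_relations oqA oqB.
Proof.
split; rewrite !exprS expr0 !mulr1 !mulrA -!scaleN1r.
- have /oq_classP := cong_rel1 q; by rewrite -!oq_eval_class.
- have /oq_classP := cong_rel2 q; by rewrite -!oq_eval_class.
Qed.

Lemma oq_universal (C : algType F) (a b : C) : oq_relations a b ->
  exists2 f : {lrmorphism qOnsager -> C}, f oqA = a /\ f oqB = b &
    forall g : {lrmorphism qOnsager -> C}, g oqA = a -> g oqB = b -> g =1 f.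
Proof.
move=> rab; pose f (x : qOnsager) := oq_eval a b (oq_repr x).
have fE t : f (oq_class t) = oq_eval a b t.
  exact: (oq_eval_cong rab (oq_classK t)).
have fZ c x : f (c *: x) = c *: f x.
  by elim/oq_ind: x => t; rewrite [c *: _]oq_scaleE !fE.
have fD : {morph f : x y / x + y}.
  by elim/oq_ind=> t; elim/oq_ind=> u; rewrite [_ + _]oq_addE !fE.
have fM : {morph f : x y / x * y}.
  by elim/oq_ind=> t; elim/oq_ind=> u; rewrite [_ * _]oq_mulE !fE.
have f1 : f 1 = 1 by rewrite fE.
have fL : linear f by move=> c x y; rewrite fD fZ.
pose h1 := GRing.isLinear.Build F qOnsager C *:%R f fL.
pose h2 := GRing.isMonoidMorphism.Build qOnsager C f (conj f1 fM).
pose fl := HB.pack_for {lrmorphism qOnsager -> C} f h1 h2.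
exists fl; first by split; [exact: fE TA|exact: fE TB].
move=> g gA gB; elim/oq_ind=> t; rewrite [RHS]fE -oq_eval_class.
elim: t => /= [|||| t IHt u IHu | t IHt u IHu | c t IHt].
- exact: gA.
- exact: gB.
- exact: raddf0.
- exact: rmorph1.
- by rewrite raddfD; congr (_ + _).
- by rewrite rmorphM; congr (_ * _).
- by rewrite linearZ; congr (_ *: _).
Qed.

End Quotient.

Section Ad.
Variables (F : fieldType) (q : F) (R : algType F) (A : R).

Definition ad (r : int) (X : R) : R := q ^ r *: (A * X) - q ^ (- r) *: (X * A).

Definition bad (n : nat) (X : R) : R :=
  if n is 0%N then (q - q^-1)^-1 *: ad 0 X
  else ((q ^+ (2 * n) - q ^- (2 * n)) *
        (q ^+ (2 * n).+1 - q ^- (2 * n).+1))^-1 *: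
       ((q ^+ (2 * n) - q ^- (2 * n)) ^+ 2 *: X + ad n%:Z (ad (- n%:Z) X)).

Fixpoint bad_prod (n : nat) (X : R) : R :=
  if n is m.+1 then bad_prod m (bad m X) else X.

Definition S_term (n : nat) (X : R) : R :=
  if n is 0%N then X
  else (q ^+ (2 * n) - q ^- (2 * n))^-1 *: bad_prod n (ad n%:Z X).

Definition S'_term (n : nat) (X : R) : R :=
  if n is 0%N then X
  else (q ^+ (2 * n) - q ^- (2 * n))^-1 *: bad_prod n (ad (- n%:Z) X).

(* The formal sums, as finitely supported sums over all n : nat; the value is
   a junk 0 when infinitely many terms are nonzero, which does not happen on
   standard elements (see S_sumE and S'_sumE). *)
Definition S_sum (X : R) : R := \sum_(n \in [set: nat]) S_term n X.
Definition S'_sum (X : R) : R := \sum_(n \in [set: nat]) S'_term n X.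

Definition level (n : nat) (X : R) : Prop := bad_prod n.+1 X = 0.

Definition standard_elt (X : R) : Prop :=
  exists2 n : nat, (0 < n)%N & bad_prod n X = 0.

Definition standard_alg : Prop := forall X : R, standard_elt X.

End Ad.

Section Sums.
Variables (F : fieldType) (q : F) (R : algType F) (A : R).

Lemma adD r : {morph ad q A r : X Y / X + Y}.
Proof.
by move=> X Y; rewrite /ad mulrDr mulrDl !scalerDr opprD addrACA.
Qed.

Lemma adZ r c X : ad q A r (c *: X) = c *: ad q A r X.
Proof.
by rewrite /ad -scalerAr -scalerAl scalerBr !scalerA ![c * _]mulrC.
Qed.

Lemma ad0 r : ad q A r 0 = 0.
Proof. by rewrite /ad mulr0 mul0r !scaler0 subrr. Qed.

Lemma adC r s X : ad q A r (ad q A s X) = ad q A s (ad q A r X).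
Proof.
rewrite /ad !(mulrBr, mulrBl, scalerBr) -!(scalerAl, scalerAr) !scalerA !mulrA.
rewrite !opprB !addrA [q ^ r * q ^ s]mulrC [q ^ (- r) * q ^ (- s)]mulrC.
rewrite [q ^ r * q ^ (- s)]mulrC [q ^ (- r) * q ^ s]mulrC.
set x := _ *: (A * A * X); set y := _ *: (A * X * A).
set z := _ *: (A * X * A); set w := _ *: (X * A * A).
by rewrite -!addrA; congr (_ + _); rewrite addrCA [RHS]addrC -!addrA;
   congr (_ + _); rewrite addrC.
Qed.

Lemma bad_ad n r X : bad q A n (ad q A r X) = ad q A r (bad q A n X).
Proof.
case: n => [|n]; rewrite /= !adZ; first by rewrite adC.
by rewrite (adD r) (adZ r) (adC (- n.+1%:Z) r) (adC n.+1 r).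
Qed.

Lemma bad0 n : bad q A n 0 = 0.
Proof. by case: n => [|n]; rewrite /= !ad0 ?scaler0 ?addr0 ?scaler0. Qed.

Lemma badD n : {morph bad q A n : X Y / X + Y}.
Proof.
by move=> X Y; case: n => [|n]; rewrite /= !adD ?scalerDr // addrACA.
Qed.

Lemma badZ n c X : bad q A n (c *: X) = c *: bad q A n X.
Proof.
case: n => [|n]; rewrite /= !adZ; first by rewrite !scalerA mulrC.
by rewrite [_ *: (c *: _)]scalerA [_ * c]mulrC -scalerA -scalerDr !scalerA mulrC.
Qed.

Lemma bad_bad m n X : bad q A m (bad q A n X) = bad q A n (bad q A m X).
Proof.
case: m => [|m]; rewrite [bad _ _ _ X]/= [LHS]/=.
  by rewrite (badZ n) (bad_ad n 0).
by rewrite (badZ n) (badD n) (badZ n) (bad_ad n m.+1) (bad_ad n (- m.+1%:Z)).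
Qed.

Lemma bad_prod_bad m n X :
  bad_prod q A m (bad q A n X) = bad q A n (bad_prod q A m X).
Proof. by elim: m X => //= m IH X; rewrite bad_bad IH. Qed.

Lemma bad_prod_ad m r X :
  bad_prod q A m (ad q A r X) = ad q A r (bad_prod q A m X).
Proof. by elim: m X => //= m IH X; rewrite bad_ad IH. Qed.

Lemma bad_prod_eq0 m n X :
  (m <= n)%N -> bad_prod q A m X = 0 -> bad_prod q A n X = 0.
Proof.
move=> /subnK <- h; elim: (n - m)%N => [|k IH]; first by rewrite add0n.
by rewrite addSn /= bad_prod_bad IH bad0.
Qed.

Lemma fsum_initial (T : zmodType) (f : nat -> T) n :
  (forall r, (n < r)%N -> f r = 0) ->
  \sum_(r \in [set: nat]) f r = \sum_(r < n.+1) f r.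
Proof.
move=> h; rewrite fsbig_ord; apply: esym.
apply: fsbig_widen => //= r [_ /= rn]; apply: h.
by rewrite ltnNge; apply/negP => rn'; apply: rn.
Qed.

Lemma S_sumE n X : level q A n X ->
  S_sum q A X = \sum_(r < n.+1) S_term q A r X.
Proof.
move=> h; apply: fsum_initial => -[//|r] rn.
by rewrite /S_term bad_prod_ad (bad_prod_eq0 rn h) ad0 scaler0.
Qed.

Lemma S'_sumE n X : level q A n X ->
  S'_sum q A X = \sum_(r < n.+1) S'_term q A r X.
Proof.
move=> h; apply: fsum_initial => -[//|r] rn.
by rewrite /S'_term bad_prod_ad (bad_prod_eq0 rn h) ad0 scaler0.
Qed.

End Sums.

Section Lusztig.
Variables (F : fieldType) (q : F).

Definition lusztigB (R : algType F) (A B : R) : R :=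
  B + ((q - q^-1) * (q ^+ 2 - q ^- 2))^-1 *:
      (q *: (A ^+ 2 * B) - (q + q^-1) *: (A * B * A) + q^-1 *: (B * A ^+ 2)).

Definition lusztig_invB (R : algType F) (A B : R) : R :=
  B + ((q - q^-1) * (q ^+ 2 - q ^- 2))^-1 *:
      (q^-1 *: (A ^+ 2 * B) - (q + q^-1) *: (A * B * A) + q *: (B * A ^+ 2)).

Local Notation A := (oqA q).
Local Notation B := (oqB q).

Definition is_lusztig (L : {lrmorphism qOnsager q -> qOnsager q})
    (Linv : qOnsager q -> qOnsager q) : Prop :=
  [/\ cancel L Linv, cancel Linv L,
      L A = A /\ L B = lusztigB A B
    & Linv A = A /\ Linv B = lusztig_invB A B].

End Lusztig.

(* Main.v *)
Require Import Defs.
From mathcomp Require Import all_boot all_order all_algebra ring zify.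
From mathcomp Require Import fsbigop.

Set Implicit Arguments.
Unset Strict Implicit.
Unset Printing Implicit Defensive.

Import GRing.Theory.
Local Open Scope ring_scope.

(** Everything rests on one fact, valid in any algebra with a chosen element
    [A]: products of standard elements are standard and the formal sum [S] is
    multiplicative on them ([levelM], [S_sumM]).  The reason is that [S] is
    formally conjugation by a function of [A].  If [A] acted diagonally with
    eigenvalues tau_a = q^(2a) + q^(-2a), an element of level [n] would only
    connect eigenvalues tau_a and tau_b with |a - b| <= n, because the factor
    [bad i] vanishes at |a - b| = i and, when a is large, for no other b; on
    such a pair [S] acts by the scalar q^(2a^2) / q^(2b^2) ([S_sym_sum_tau]).  These scalars are
    quotients psi(a) / psi(b), so they multiply along a chain a, b, c, which is
    the identity S(X Y) = S(X) S(Y).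

    The scalar is computed by creative telescoping: raising b by one turns the
    partial sums of [S] into a geometric-type recursion whose defect is a single
    explicit product ([S_sym_sum_step]), and that product vanishes at the
    relevant eigenvalues.

    In general [A] need not be diagonalizable, and the argument is transported
    through polynomials.  A polynomial in three commuting variables l, m, r is
    evaluated at a pair (X, Y) by sending l^i m^j r^k to A^i X A^j Y A^k
    ([eval2]).  If X has level n and Y has level k, a polynomial that vanishes
    at all the triples (tau_a, tau_b, tau_c) with |a - b| <= n and |b - c| <= k
    is sent to 0 ([eval2_vanishing]): divide by the polynomial expressing the
    level of Y, then by the one expressing the level of X; the remainders have
    too many roots, since the tau_a are pairwise distinct when q is not a root
    of unity.  Both the level of X Y and the identity S(X Y) = S(X) S(Y) are the
    vanishing of such polynomials.

    For the q-Onsager algebra, the first defining relation says precisely that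
    [B] has level 1.  Hence all elements are standard, and [S] is an algebra
    endomorphism determined by its values on the two generators, which are read
    off from the first two terms of the sum.  The sum [S'] is [S] for the
    parameter q^-1 ([S'_sumV]), so no separate treatment is necessary. *)

(** * Symbols of the operators in commuting variables *)

Section Symbols.
Variables (F : fieldType) (q : F) (K : comNzRingType).
Variables (iota : {rmorphism F -> K}) (u v : K).

(** The operators built from [A] are polynomials in the commuting left and right
    multiplications by [A]; their symbols replace these by [u] and [v] in a
    commutative ring [K] that receives the scalars through [iota]. *)
Definition ad_sym (r : int) : K := iota (q ^ r) * u - iota (q ^ (- r)) * v.

Definition bad_sym (n : nat) : K :=
  if n is 0%N then iota (q - q^-1)^-1 * ad_sym 0
  else iota ((q ^+ (2 * n) - q ^- (2 * n)) *
             (q ^+ (2 * n).+1 - q ^- (2 * n).+1))^-1 *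
       (iota ((q ^+ (2 * n) - q ^- (2 * n)) ^+ 2)
        + ad_sym n%:Z * ad_sym (- n%:Z)).

Fixpoint bad_prod_sym (n : nat) : K :=
  if n is m.+1 then bad_prod_sym m * bad_sym m else 1.

Definition S_sym (n : nat) : K :=
  if n is 0%N then 1
  else iota (q ^+ (2 * n) - q ^- (2 * n))^-1 * (bad_prod_sym n * ad_sym n%:Z).

Definition S_sym_sum (n : nat) : K := \sum_(r < n.+1) S_sym r.

End Symbols.

Section SymbolsMorphism.
Variables (F : fieldType) (q : F) (K K' : comNzRingType).
Variables (iota : {rmorphism F -> K}) (iota' : {rmorphism F -> K'}).
Variables (sigma : {rmorphism K -> K'}) (u v : K).
Hypothesis sigma_iota : forall c, sigma (iota c) = iota' c.

Lemma ad_sym_morph r :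
  sigma (ad_sym q iota u v r) = ad_sym q iota' (sigma u) (sigma v) r.
Proof. by rewrite rmorphB !rmorphM /= !sigma_iota. Qed.

Lemma bad_prod_sym_morph n :
  sigma (bad_prod_sym q iota u v n)
  = bad_prod_sym q iota' (sigma u) (sigma v) n.
Proof.
elim: n => [|n IHn]; rewrite /= ?rmorph1 // rmorphM IHn /=; congr (_ * _).
case: n {IHn} => [|n]; rewrite /bad_sym rmorphM.
  by rewrite ad_sym_morph /= sigma_iota.
rewrite sigma_iota [X in _ * X]rmorphD sigma_iota; congr (_ * (_ + _)).
by rewrite rmorphM !ad_sym_morph.
Qed.

Lemma S_sym_sum_morph n :
  sigma (S_sym_sum q iota u v n) = S_sym_sum q iota' (sigma u) (sigma v) n.
Proof.
rewrite /S_sym_sum rmorph_sum; apply: eq_bigr => r _.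
case: (nat_of_ord r) => {r} [|r]; first exact: rmorph1.
rewrite [LHS]rmorphM sigma_iota; congr (_ * _).
by rewrite [LHS]rmorphM ad_sym_morph bad_prod_sym_morph.
Qed.

End SymbolsMorphism.

(** * Values of the symbols at the eigenvalues *)

Section Points.
Variables (F : fieldType) (q : F).
Hypotheses (q_neq0 : q != 0) (q_nroot : not_root_of_unity q).

Lemma qpowB_neq0 m : (0 < m)%N -> q ^+ m - q ^- m != 0.
Proof.
move=> m_gt0; have qm0 : q ^+ m != 0 by rewrite expf_neq0.
rewrite -(inj_eq (mulfI qm0)) mulr0 mulrBr mulfV // -exprD subr_eq0.
by rewrite q_nroot // addn_gt0 m_gt0.
Qed.

Definition tau (a : nat) : F := q ^+ (2 * a) + q ^- (2 * a).

Lemma tau_inj : injective tau.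
Proof.
have wlog a b : (a < b)%N -> tau a != tau b.
  move=> ltab; rewrite -subr_eq0.
  have d1 : q ^+ (2 * (b - a)) - 1 != 0.
    by rewrite subr_eq0 q_nroot //; lia.
  have d2 : q ^+ (2 * (a + b)) - 1 != 0.
    by rewrite subr_eq0 q_nroot //; lia.
  have -> : tau a - tau b = - (q ^+ (2 * (b - a)) - 1)
      * (q ^+ (2 * (a + b)) - 1) / q ^+ (2 * b).
    have := subnKC (ltnW ltab); set c := (b - a)%N => <-.
    rewrite /tau !mulnDr !exprD.
    have : q ^+ (2 * a) != 0 by rewrite expf_neq0.
    have : q ^+ (2 * c) != 0 by rewrite expf_neq0.
    set x := q ^+ (2 * a); set y := q ^+ (2 * c) => ? ?.
    by field; rewrite !expf_neq0.
  by rewrite !mulf_eq0 oppr_eq0 invr_eq0 !negb_or d1 d2 expf_neq0.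
move=> a b eq_tau; case: (ltngtP a b) => // /wlog; by rewrite eq_tau eqxx.
Qed.

Local Notation idF := (idfun : {rmorphism F -> F}).

(** With l = x + x^-1 this is (y - c^2 x)(y - c^2 x^-1) / y: for c = q^i it
    vanishes when y + y^-1 is the eigenvalue i steps away from l. *)
Definition node_factor (l y c : F) : F := y + c ^+ 4 / y - c ^+ 2 * l.

(** The product of the node factors for the steps i = -n, ..., n - 1, which are
    the ones where both y and q^2 y stay within n steps of x^{+1} or x^{-1}. *)
Definition node_prod (l y : F) (n : nat) : F :=
  \prod_(i < n) (node_factor l y (q ^- i.+1) * node_factor l y (q ^+ i)).

Definition qpow_fact (m : nat) : F := \prod_(j < m) (q ^+ j.+1 - q ^- j.+1).

Lemma qpow_factS m : qpow_fact m.+1 = qpow_fact m * (q ^+ m.+1 - q ^- m.+1).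
Proof. exact: big_ord_recr. Qed.

Lemma qpow_fact_neq0 m : qpow_fact m != 0.
Proof. by apply/prodf_neq0 => j _; apply: qpowB_neq0. Qed.

Lemma bad_symS_node l y n : y != 0 ->
  bad_sym q idF l (y + y^-1) n.+1
  = ((q ^+ (2 * n).+2 - q ^- (2 * n).+2) * (q ^+ (2 * n).+3 - q ^- (2 * n).+3))^-1
    * (node_factor l y (q ^- n.+1) * node_factor l y (q ^+ n.+1)).
Proof.
move=> y_neq0; rewrite /bad_sym mulnS !addSn add0n; congr (_^-1 * _) => /=.
rewrite /ad_sym /= opprK -exprnN -exprnP.
have -> : (2 * n).+2 = (n.+1 * 2)%N by lia.
rewrite exprM /node_factor.
have : q ^+ n.+1 != 0 by rewrite expf_neq0.
move: (q ^+ n.+1) => Q Q0; field; exact/andP.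
Qed.

(** The nodes of (bad A)_(n+1) are the steps i = -n, ..., n; all but the last of
    them are collected in [node_prod]. *)
Lemma bad_prod_sym_node l y n : y != 0 ->
  bad_prod_sym q idF l (y + y^-1) n.+1
  = - (qpow_fact (2 * n).+1)^-1 * node_factor l y (q ^+ n) * node_prod l y n.
Proof.
move=> y_neq0; elim: n => [|n IHn].
  rewrite /= /qpow_fact /node_prod !big_ord1 big_ord0 /bad_sym /ad_sym.
  rewrite /node_factor oppr0 expr0z /= !expr0 !expr1.
  by field; rewrite y_neq0 q_neq0 subr_eq0 -expr2 q_nroot.
transitivity (bad_prod_sym q idF l (y + y^-1) n.+1
  * bad_sym q idF l (y + y^-1) n.+1); first by [].
rewrite IHn bad_symS_node // /node_prod big_ord_recr /=.
rewrite mulnS !addSn add0n (qpow_factS (2 * n).+2) (qpow_factS (2 * n).+1).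
rewrite !invfM; ring.
Qed.

Lemma node_factor_shift l y c : c != 0 ->
  node_factor l (q ^+ 2 * y) (q * c) = q ^+ 2 * node_factor l y c.
Proof.
move=> c0; rewrite /node_factor.
have [->|y0] := eqVneq y 0; first by rewrite mulr0 !invr0; ring.
by field; apply/andP.
Qed.

(** Replacing y by q^2 y moves every node by one step, so the symmetric window
    -n, ..., n becomes -n-1, ..., n-1; it shares [node_prod] with the unshifted
    window, which is what makes the telescoping below possible. *)
Lemma node_prod_shift l y n :
  node_factor l (q ^+ 2 * y) (q ^+ n) * node_prod l (q ^+ 2 * y) n
  = q ^+ (4 * n).+2 * node_factor l y (q ^- n.+1) * node_prod l y n.
Proof.
have shiftN m : node_factor l (q ^+ 2 * y) (q ^- m)
    = q ^+ 2 * node_factor l y (q ^- m.+1).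
  rewrite -node_factor_shift ?invr_eq0 ?expf_neq0 //.
  by rewrite (exprS q m) invfM mulVKf.
have shiftS m : node_factor l (q ^+ 2 * y) (q ^+ m.+1)
    = q ^+ 2 * node_factor l y (q ^+ m).
  by rewrite (exprS q m) node_factor_shift ?expf_neq0.
elim: n => [|n IHn].
  rewrite /node_prod !big_ord0 !mulr1; have := shiftN 0%N.
  by rewrite expr0 invr1.
rewrite /node_prod !big_ord_recr -!/(node_prod _ _ _) /=.
rewrite shiftS shiftN.
have -> : q ^+ (4 * n.+1).+2 = q ^+ 4 * q ^+ (4 * n).+2.
  by rewrite -exprD; congr (_ ^+ _); lia.
transitivity (q ^+ 4 * node_factor l y (q ^+ n) * node_factor l y (q ^- n.+2)
  * (node_factor l (q ^+ 2 * y) (q ^+ n) * node_prod l (q ^+ 2 * y) n)).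
  ring.
by rewrite IHn; ring.
Qed.

(** Telescoping in n: the right-hand side is forced, up to its constant, by the
    nodes at which both partial sums are already complete and by the symmetry
    y -> 1 / (q^2 y), and the constant by the leading coefficient in y. *)
Lemma S_sym_sum_step l y n : y != 0 ->
  q ^+ 2 * y ^+ 2 * S_sym_sum q idF l (q ^+ 2 * y + (q ^+ 2 * y)^-1) n
  - S_sym_sum q idF l (y + y^-1) n
  = (q ^+ 2 * y ^+ 2 - 1) * q ^+ (3 * n) / qpow_fact (2 * n) * node_prod l y n.
Proof.
move=> y0; elim: n => [|n IHn].
  rewrite /S_sym_sum !big_ord1 /qpow_fact /node_prod !big_ord0 muln0 expr0 invr1 /=.
  by rewrite !mulr1.
have SE z : S_sym_sum q idF l z n.+1 = S_sym_sum q idF l z n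
    + (q ^+ (2 * n).+2 - q ^- (2 * n).+2)^-1
      * (bad_prod_sym q idF l z n.+1 * (q ^+ n.+1 * l - q ^- n.+1 * z)).
  by rewrite /S_sym_sum big_ord_recr /= mulnS.
have qy0 : q ^+ 2 * y != 0 by rewrite mulf_neq0 // expf_neq0.
have -> : qpow_fact (2 * n.+1) = qpow_fact (2 * n)
    * (q ^+ (2 * n).+1 - q ^- (2 * n).+1) * (q ^+ (2 * n).+2 - q ^- (2 * n).+2).
  by rewrite mulnS !qpow_factS.
rewrite !SE [X in X - _]mulrDr opprD addrACA {}IHn !bad_prod_sym_node //.
rewrite -[_ * node_prod l (_ * y) n]mulrA node_prod_shift qpow_factS.
have -> : node_prod l y n.+1 = node_prod l y n
    * (node_factor l y (q ^- n.+1) * node_factor l y (q ^+ n)).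
  exact: big_ord_recr.
rewrite /node_factor.
have := @qpowB_neq0 (2 * n).+1 isT; have := @qpowB_neq0 (2 * n).+2 isT.
move: (qpow_fact_neq0 (2 * n)); move: (qpow_fact _) (node_prod _ _ _) => f E f0.
have -> : q ^+ (2 * n).+2 = (q * q ^+ n) ^+ 2.
  by rewrite -exprS -exprM; congr (_ ^+ _); lia.
have -> : q ^+ (2 * n).+1 = q * (q ^+ n) ^+ 2 by rewrite exprS mulnC exprM.
have -> : q ^+ (4 * n).+2 = q ^+ 2 * (q ^+ n) ^+ 4.
  by rewrite mulnC !exprS exprM; ring.
have -> : q ^+ (3 * n.+1) = q ^+ 3 * (q ^+ n) ^+ 3.
  by rewrite -exprM -exprD; congr (_ ^+ _); lia.
rewrite (mulnC 3%N n) exprM (exprS q n).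
have : q ^+ n != 0 by rewrite expf_neq0.
move: (q ^+ n) => Q Q0 d2 d1.
have sqrB1 (z : F) : z != 0 -> z - z^-1 != 0 -> z * z - 1 != 0.
  move=> z0; apply: contraNneq => z2; rewrite -(mulfK z0 (z - _)) mulrBl mulVf //.
  by rewrite z2 mul0r.
have qQ0 : q * Q != 0 by rewrite mulf_neq0.
have {d2}d2 := sqrB1 _ (expf_neq0 2 qQ0) d2.
have {d1}d1 := sqrB1 _ (mulf_neq0 q_neq0 (expf_neq0 2 Q0)) d1.
(* Up to the common factor E = node_prod l y n, an identity between rational
   functions of q, Q = q^n, y and l remains. *)
field; rewrite y0 Q0 q_neq0 f0 d1.
have -> : (q * Q * (q * Q)) ^+ 2 = (q * Q) ^+ 2 * (q * Q) ^+ 2 by ring.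
by rewrite d2.
Qed.

Lemma tauS a : tau a.+1 = q ^+ 2 * q ^+ (2 * a) + (q ^+ 2 * q ^+ (2 * a))^-1.
Proof. by rewrite /tau mulnS exprD. Qed.

Lemma node_factor_tau a b c : c != 0 ->
  c ^+ 2 * q ^+ (2 * a) = q ^+ (2 * b) ->
  node_factor (tau a) (q ^+ (2 * b)) c = 0.
Proof.
move=> c0 <-; rewrite /node_factor /tau.
have : q ^+ (2 * a) != 0 by rewrite expf_neq0.
by move: (q ^+ _) => x x0; field; apply/andP.
Qed.

Lemma node_prod_tau a b n : (b < a + n)%N -> (a <= b + n)%N ->
  node_prod (tau a) (q ^+ (2 * b)) n = 0.
Proof.
move=> ltb leb; case: (leqP a b) => ab.
  have lti : (b - a < n)%N by lia.
  rewrite /node_prod (bigD1 (Ordinal lti)) //= [X in _ * X * _]node_factor_tau.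
  - by rewrite mulr0 mul0r.
  - exact: expf_neq0.
  by rewrite -exprM -exprD; congr (_ ^+ _); lia.
have lti : ((a - b).-1 < n)%N by lia.
rewrite /node_prod (bigD1 (Ordinal lti)) //= [X in X * _ * _]node_factor_tau.
- by rewrite !mul0r.
- by rewrite invr_eq0 expf_neq0.
have -> : (2 * a = (a - b).-1.+1 * 2 + 2 * b)%N by lia.
by rewrite exprD exprM exprVn mulKf // !expf_neq0.
Qed.

Lemma bad_prod_sym_tau a b n : (b <= a + n)%N -> (a <= b + n)%N ->
  bad_prod_sym q idF (tau a) (tau b) n.+1 = 0.
Proof.
move=> leb lea; rewrite bad_prod_sym_node ?expf_neq0 //.
move: leb; rewrite leq_eqVlt => /predU1P[->|ltb].
  rewrite node_factor_tau ?mulr0 ?mul0r ?expf_neq0 // -exprM -exprD.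
  by congr (_ ^+ _); lia.
by rewrite node_prod_tau ?mulr0.
Qed.

(** By [S_sym_sum_step] the product of the sum by q^(2 b^2) is unchanged when b
    moves by one step inside the window |a - b| <= n, and at b = a every term
    but the first contains the factor u - v = 0. *)
Lemma S_sym_sum_tau a b n : (b <= a + n)%N -> (a <= b + n)%N ->
  S_sym_sum q idF (tau a) (tau b) n = q ^+ (2 * a ^ 2) / q ^+ (2 * b ^ 2).
Proof.
move=> leb lea; pose h c := q ^+ (2 * c ^ 2) * S_sym_sum q idF (tau a) (tau c) n.
have hS c : (c < a + n)%N -> (a <= c + n)%N -> h c.+1 = h c.
  move=> ltc lec; have := S_sym_sum_step (tau a) n (expf_neq0 (2 * c) q_neq0).
  rewrite -tauS node_prod_tau // mulr0 => /eqP; rewrite subr_eq0 => /eqP.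
  rewrite -/(tau c) /h => <-; rewrite mulrA -exprM -!exprD.
  by congr (q ^+ _ * _); rewrite expnS expn1; lia.
have hD c d : (a <= c + n)%N -> (c + d <= a + n)%N -> h (c + d)%N = h c.
  move=> lec; elim: d => [|d IHd] led; first by rewrite addn0.
  by rewrite addnS hS ?IHd //; lia.
have ha : h a = q ^+ (2 * a ^ 2).
  rewrite /h /S_sym_sum big_ord_recl big1 ?addr0 ?mulr1 // => i _.
  rewrite /S_sym /= -/(bad_prod_sym _ _ _ _ i.+1) bad_prod_sym_tau ?leq_addr //.
  by rewrite mul0r mulr0.
have hb : h b = h a.
  case: (leqP a b) => ab; first by rewrite -(subnKC ab) hD //; lia.
  by rewrite -(subnKC (ltnW ab)) hD //; lia.
by rewrite -ha -hb /h mulrC mulKf // expf_neq0.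
Qed.

End Points.

(** * Polynomials vanishing on a grid *)

(** If the roots prescribed over each specialization [ev s] are at least as many
    as the degree of [P], the remainder modulo [P] specializes to 0 everywhere;
    [J] is the ideal of coefficients that this forces.  The parameter [J] makes
    the lemma iterable, one variable at a time. *)
Lemma modp_vanishing (K : idomainType) (F : fieldType) (T : Type)
    (D : pred T) (ev : T -> {rmorphism K -> F}) (roots : T -> seq F)
    (J : K -> Prop) (P p : {poly K}) :
  (forall c, (forall s, D s -> ev s c = 0) -> J c) ->
  lead_coef P \is a GRing.unit ->
  (forall s, D s -> uniq (roots s) /\ (size P <= (size (roots s)).+1)%N) ->
  (forall s t, D s -> t \in roots s -> (map_poly (ev s) P).[t] = 0) ->
  (forall s t, D s -> t \in roots s -> (map_poly (ev s) p).[t] = 0) ->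
  exists h, forall i, J (p - h * P)`_i.
Proof.
move=> Jev Punit rootsP P0 p0; exists (p %/ P) => i.
have rE : p - p %/ P * P = p %% P.
  by rewrite {1}(Pdiv.IdomainUnit.divp_eq Punit p) addrAC subrr add0r.
apply: Jev => s Ds; rewrite rE.
have [uniq_s size_s] := rootsP s Ds.
have -> : ev s (p %% P)`_i = (map_poly (ev s) (p %% P))`_i by rewrite coef_map.
suff -> : map_poly (ev s) (p %% P) = 0 by rewrite coef0.
apply/eqP; apply: contraTT isT => r_neq0.
have : all (root (map_poly (ev s) (p %% P))) (roots s).
  apply/allP => t ts; rewrite /root -rE rmorphB rmorphM /= hornerD hornerN hornerM.
  by rewrite P0 // p0 // mulr0 subrr.
(* The specialized remainder has size at most that of P minus 1. *)
move=> /(max_poly_roots r_neq0) /(_ uniq_s); rewrite ltnNge.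
have -> // : (size (map_poly (ev s) (p %% P)) <= size (roots s))%N.
rewrite -ltnS; apply: leq_trans size_s; apply: leq_ltn_trans (size_poly _ _) _.
by rewrite ltn_modp -lead_coef_eq0; apply: contraTneq Punit => ->; rewrite unitr0.
Qed.

(** The level polynomials have a unit leading coefficient, so that division by
    them is possible over a ring of polynomials. *)
Section LeadCoef.
Variables (F : fieldType) (q : F) (K : idomainType).
Variables (iota : {rmorphism F -> K}) (kappa : K).
Hypotheses (q_neq0 : q != 0) (q_nroot : not_root_of_unity q).

Local Notation iotaP := (polyC \o iota : {rmorphism F -> {poly K}}).

Lemma iota_unit c : c != 0 -> iota c \is a GRing.unit.
Proof. by move=> c0; rewrite rmorph_unit ?unitfE. Qed.

Lemma ad_sym_polyE r : ad_sym q iotaP kappa%:P 'X r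
  = - (iota (q ^ (- r)))%:P * 'X + (iota (q ^ r) * kappa)%:P.
Proof. by rewrite /ad_sym /= polyCM mulNr addrC. Qed.

Lemma size_ad_sym r : size (ad_sym q iotaP kappa%:P 'X r) = 2%N.
Proof.
rewrite ad_sym_polyE -polyCN size_MXaddC polyC_eq0 oppr_eq0.
have u : iota (q ^ (- r)) != 0 by rewrite fmorph_eq0 expfz_neq0.
by rewrite (negPf u) size_polyC oppr_eq0 u.
Qed.

Lemma lead_coef_ad_sym r :
  lead_coef (ad_sym q iotaP kappa%:P 'X r) = - iota (q ^ (- r)).
Proof.
by rewrite lead_coefE size_ad_sym ad_sym_polyE -polyCN coefD coefMX !coefC addr0.
Qed.

Lemma bad_sym_lead n :
  lead_coef (bad_sym q iotaP kappa%:P 'X n) \is a GRing.unit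
  /\ (size (bad_sym q iotaP kappa%:P 'X n) <= 2 + (0 < n))%N.
Proof.
have adU r : lead_coef (ad_sym q iotaP kappa%:P 'X r) \is a GRing.unit.
  by rewrite lead_coef_ad_sym unitrN iota_unit ?expfz_neq0.
case: n => [|n]; rewrite /bad_sym /=.
  split.
    rewrite lead_coefM unitrM adU andbT lead_coefC iota_unit // invr_eq0.
    by have := qpowB_neq0 q_neq0 q_nroot (m := 1) isT; rewrite expr1.
  by rewrite (leq_trans (size_polyMleq _ _)) // size_ad_sym size_polyC; case: eqP.
have sz : size (ad_sym q iotaP kappa%:P 'X n.+1%:Z
  * ad_sym q iotaP kappa%:P 'X (- n.+1%:Z)) = 3%N.
  by rewrite size_mul ?size_ad_sym // -size_poly_eq0 size_ad_sym.
split.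
  rewrite lead_coefM lead_coefDr; last first.
    by rewrite sz (leq_ltn_trans (size_polyC_leq1 _)).
  rewrite lead_coefM lead_coefC !unitrM !adU !andbT iota_unit // invr_eq0.
  by rewrite mulf_neq0 // qpowB_neq0.
rewrite (leq_trans (size_polyMleq _ _)) // [_%:P + _]addrC size_polyDl; last first.
  by rewrite sz (leq_ltn_trans (size_polyC_leq1 _)).
by rewrite sz size_polyC; case: eqP.
Qed.

Lemma bad_prod_sym_lead n :
  lead_coef (bad_prod_sym q iotaP kappa%:P 'X n.+1) \is a GRing.unit
  /\ (size (bad_prod_sym q iotaP kappa%:P 'X n.+1) <= (2 * n).+2)%N.
Proof.
elim: n => [|n [IHl IHs]].
  by rewrite [bad_prod_sym _ _ _ _ _]mul1r; apply: (bad_sym_lead 0).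
rewrite [bad_prod_sym _ _ _ _ _]/= -/(bad_prod_sym _ _ _ _ n.+1).
have [l s] := bad_sym_lead n.+1; rewrite lead_coefM unitrM IHl l; split => //.
apply: leq_trans (size_polyMleq _ _) _; move: s IHs => /=; lia.
Qed.

End LeadCoef.

(** * Evaluating symbols in the algebra *)

(** A relation between symbols and algebra elements that is linear and matches
    [u], [v] with left and right multiplication by [A] relates the symbol of
    each operator to the operator itself. *)
Section Intertwine.
Variables (F : fieldType) (q : F) (R : algType F) (A : R) (K : comNzRingType).
Variables (iota : {rmorphism F -> K}) (u v : K) (Rel : K -> R -> Prop).
Hypotheses
  (RelD : forall w w' Z Z', Rel w Z -> Rel w' Z' -> Rel (w + w') (Z + Z'))
  (RelZ : forall c w Z, Rel w Z -> Rel (iota c * w) (c *: Z))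
  (Rell : forall w Z, Rel w Z -> Rel (u * w) (A * Z))
  (Relr : forall w Z, Rel w Z -> Rel (v * w) (Z * A)).

Lemma rel_ad r w Z : Rel w Z -> Rel (ad_sym q iota u v r * w) (ad q A r Z).
Proof.
move=> wZ; rewrite /ad_sym /ad mulrBl -!mulrA -scaleNr -mulNr -rmorphN.
by apply: RelD; apply: RelZ; [apply: Rell|apply: Relr].
Qed.

Lemma rel_bad n w Z : Rel w Z -> Rel (bad_sym q iota u v n * w) (bad q A n Z).
Proof.
move=> wZ; case: n => [|n]; rewrite /bad_sym /bad -mulrA; apply: RelZ.
  exact: rel_ad.
by rewrite mulrDl -mulrA; apply: RelD; [apply: RelZ|do 2!apply: rel_ad].
Qed.

Lemma rel_bad_prod n w Z :
  Rel w Z -> Rel (bad_prod_sym q iota u v n * w) (bad_prod q A n Z).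
Proof.
elim: n w Z => [|n IHn] w Z wZ /=; first by rewrite mul1r.
by rewrite -mulrA; apply/IHn/rel_bad.
Qed.

Lemma rel_S_sum n w Z :
  Rel w Z ->
  Rel (S_sym_sum q iota u v n * w) (\sum_(r < n.+1) S_term q A r Z).
Proof.
move=> wZ; rewrite /S_sym_sum mulr_suml.
apply: (big_ind2 Rel) => [|? ? ? ? ? ?|r _]; [|exact: RelD|].
  by rewrite -(scale0r Z) -(mul0r w) -(rmorph0 iota); apply: RelZ.
case: (nat_of_ord r) => {r} [|r]; first by rewrite /S_sym mul1r.
rewrite /S_sym -2!mulrA; apply/RelZ/rel_bad_prod.
exact: rel_ad.
Qed.

End Intertwine.

Section Append.
Variables (F : fieldType) (R : algType F) (A : R) (K : comNzRingType).
Variables (iota : {rmorphism F -> K}) (kappa : K) (g : {additive K -> R}).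
Variable (Y : R).
Hypotheses (gZ : forall c w, g (iota c * w) = c *: g w)
  (gr : forall w, g (kappa * w) = g w * A).

(** Given [g] from [K] to the algebra, sends c 'X^i to g(c) Y A^i.  Starting from
    polynomials in [A] and iterating evaluates words A^i X A^j Y A^k. *)
Definition append : {additive {poly K} -> R} :=
  horner_eval A \o map_poly (Y \o* g).

Lemma appendC c : append c%:P = g c * Y.
Proof. by rewrite /append /= map_polyC /horner_eval hornerC. Qed.

Lemma appendMX (p : {poly K}) : append (p * 'X) = append p * A.
Proof.
rewrite /append /= /horner_eval -hornerMX; congr (_.[_]).
apply/polyP => i; rewrite coef_map_id0 ?coefMX; last by rewrite /= raddf0 mul0r.
case: ifP => _; first by rewrite /= raddf0 mul0r.
by rewrite coef_map_id0 //= raddf0 mul0r.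
Qed.

Lemma append_coef0 (p : {poly K}) : (forall i, g p`_i = 0) -> append p = 0.
Proof.
move=> p0; rewrite /append /= /horner_eval.
suff -> : map_poly (Y \o* g) p = 0 by rewrite horner0.
apply/polyP => i; rewrite coef_map_id0 /= ?raddf0 ?mul0r // p0 mul0r.
by rewrite coef0.
Qed.

Lemma appendZ c (p : {poly K}) : append ((polyC \o iota) c * p) = c *: append p.
Proof.
elim/poly_ind: p => [|p d IHp]; first by rewrite mulr0 raddf0 scaler0.
rewrite mulrDr mulrA !(raddfD append) scalerDr !appendMX IHp -scalerAl.
rewrite -[(polyC \o iota) c]/((iota c)%:P) -polyCM.
by rewrite !appendC gZ -scalerAl.
Qed.

Lemma append_left u (p : {poly K}) :
  (forall w, g (u * w) = A * g w) -> append (u%:P * p) = A * append p.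
Proof.
move=> gl; elim/poly_ind: p => [|p d IHp]; first by rewrite !(mulr0, raddf0).
rewrite mulrDr mulrA !(raddfD append) mulrDr !appendMX IHp -polyCM !appendC gl.
by rewrite !mulrA.
Qed.

(** The element [kappa] stands for the factor [A] immediately to the left of [Y].
    The last factor may carry an operator: [w], a polynomial in [kappa] and 'X,
    acts as [Z], obtained from [Y] by multiplications by [A], whatever stands in
    front. *)
Definition append_rel (w : {poly K}) (Z : R) : Prop :=
  forall c, append (c%:P * w) = g c * Z.

Lemma append_rel1 : append_rel 1 Y.
Proof. by move=> c; rewrite mulr1 appendC. Qed.

Lemma append_relD w w' Z Z' :
  append_rel w Z -> append_rel w' Z' -> append_rel (w + w') (Z + Z').
Proof. by move=> wZ wZ' c; rewrite !mulrDr (raddfD append) wZ wZ'. Qed.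

Lemma append_relZ c w Z :
  append_rel w Z -> append_rel ((polyC \o iota) c * w) (c *: Z).
Proof.
by move=> wZ d; rewrite mulrCA appendZ wZ scalerAr.
Qed.

Lemma append_rell w Z : append_rel w Z -> append_rel (kappa%:P * w) (A * Z).
Proof.
by move=> wZ c; rewrite mulrA -polyCM wZ mulrC gr mulrA.
Qed.

Lemma append_relr w Z : append_rel w Z -> append_rel ('X * w) (Z * A).
Proof. by move=> wZ c; rewrite mulrCA mulrC appendMX wZ mulrA. Qed.

Lemma append_rel0 w (h : {poly K}) : append_rel w 0 -> append (h * w) = 0.
Proof.
move=> w0; elim/poly_ind: h => [|h c IHh]; first by rewrite mul0r raddf0.
by rewrite mulrDl (raddfD append) w0 mulr0 addr0 mulrAC appendMX IHh mul0r.
Qed.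

Variable q : F.
Local Notation iotaP := (polyC \o iota : {rmorphism F -> {poly K}}).

Lemma append_bad_prod n :
  append_rel (bad_prod_sym q iotaP kappa%:P 'X n) (bad_prod q A n Y).
Proof.
rewrite -[bad_prod_sym _ _ _ _ _]mulr1.
apply: (@rel_bad_prod F q R A _ iotaP kappa%:P 'X append_rel); last first.
- exact: append_rel1.
- exact: append_relr.
- exact: append_rell.
- exact: append_relZ.
- exact: append_relD.
Qed.

Lemma append_S_sum n :
  append_rel (S_sym_sum q iotaP kappa%:P 'X n) (\sum_(r < n.+1) S_term q A r Y).
Proof.
rewrite -[S_sym_sum _ _ _ _ _]mulr1.
apply: (@rel_S_sum F q R A _ iotaP kappa%:P 'X append_rel); last first.
- exact: append_rel1.
- exact: append_relr.
- exact: append_rell.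
- exact: append_relZ.
- exact: append_relD.
Qed.

End Append.

(** * Multiplicativity of the formal sum *)

Section Multiplicativity.
Variables (F : fieldType) (q : F) (R : algType F) (A X Y : R).
Hypotheses (q_neq0 : q != 0) (q_nroot : not_root_of_unity q).

Local Notation K0 := {poly F}.
Local Notation K1 := {poly {poly F}}.
Local Notation K2 := {poly {poly {poly F}}}.
Local Notation idF := (idfun : {rmorphism F -> F}).
Local Notation iota0 := (polyC : {rmorphism F -> K0}).
Local Notation iota1 := (polyC \o iota0 : {rmorphism F -> K1}).
Local Notation iota2 := (polyC \o iota1 : {rmorphism F -> K2}).

Definition eval0 : {additive K0 -> R} := horner_alg A.
Definition eval1 : {additive K1 -> R} := append A eval0 X.
Definition eval2 : {additive K2 -> R} := append A eval1 Y.

Lemma eval0Z c w : eval0 (iota0 c * w) = c *: eval0 w.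
Proof. by rewrite /eval0 /= mul_polyC linearZ /= mulr_algl. Qed.

Lemma eval0_left w : eval0 ('X * w) = A * eval0 w.
Proof. by rewrite /eval0 /= rmorphM /= horner_algX. Qed.

Lemma eval0_right w : eval0 ('X * w) = eval0 w * A.
Proof. by rewrite mulrC /eval0 /= rmorphM /= horner_algX. Qed.

Lemma eval0_1 : eval0 1 = 1.
Proof. exact: rmorph1. Qed.

Lemma eval1Z c w : eval1 (iota1 c * w) = c *: eval1 w.
Proof. by apply: appendZ; apply: eval0Z. Qed.

Lemma eval1_left w : eval1 ('X%:P * w) = A * eval1 w.
Proof. by apply: append_left; apply: eval0_left. Qed.

Lemma eval1_right w : eval1 ('X * w) = eval1 w * A.
Proof. by rewrite mulrC; apply: appendMX. Qed.

Lemma eval1_1 : eval1 1 = X.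
Proof. by rewrite /eval1 appendC eval0_1 mul1r. Qed.

Lemma eval2Z c w : eval2 (iota2 c * w) = c *: eval2 w.
Proof. by apply: appendZ; apply: eval1Z. Qed.

Lemma eval2_left w : eval2 ('X%:P%:P * w) = A * eval2 w.
Proof. by apply: append_left; apply: eval1_left. Qed.

Lemma eval2_right w : eval2 ('X * w) = eval2 w * A.
Proof. by rewrite mulrC; apply: appendMX. Qed.

Lemma eval2_1 : eval2 1 = X * Y.
Proof. by rewrite /eval2 appendC eval1_1. Qed.

Let rel2 (w : K2) (Z : R) := eval2 w = Z.

Lemma eval2_bad_prod n :
  eval2 (bad_prod_sym q iota2 'X%:P%:P 'X n) = bad_prod q A n (X * Y).
Proof.
rewrite -[bad_prod_sym _ _ _ _ _]mulr1.
apply: (@rel_bad_prod F q R A _ iota2 'X%:P%:P 'X rel2); last first.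
- exact: eval2_1.
- by move=> w Z <-; apply: eval2_right.
- by move=> w Z <-; apply: eval2_left.
- by move=> c w Z <-; apply: eval2Z.
- by move=> w w' Z Z' <- <-; apply: raddfD.
Qed.

Lemma eval2_S_sum n :
  eval2 (S_sym_sum q iota2 'X%:P%:P 'X n)
  = \sum_(r < n.+1) S_term q A r (X * Y).
Proof.
rewrite -[S_sym_sum _ _ _ _ _]mulr1.
apply: (@rel_S_sum F q R A _ iota2 'X%:P%:P 'X rel2); last first.
- exact: eval2_1.
- by move=> w Z <-; apply: eval2_right.
- by move=> w Z <-; apply: eval2_left.
- by move=> c w Z <-; apply: eval2Z.
- by move=> w w' Z Z' <- <-; apply: raddfD.
Qed.

Definition spec0 (a : nat) : {rmorphism K0 -> F} := horner_eval (tau q a).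
Definition spec1 (a b : nat) : {rmorphism K1 -> F} :=
  horner_eval (tau q b) \o map_poly (spec0 a).
Definition spec2 (a b c : nat) : {rmorphism K2 -> F} :=
  horner_eval (tau q c) \o map_poly (spec1 a b).

Lemma spec0_const a c : spec0 a c%:P = c.
Proof. exact: hornerC. Qed.

Lemma spec1_const a b c : spec1 a b c%:P = spec0 a c.
Proof. by rewrite /spec1 /= map_polyC; apply: hornerC. Qed.

Lemma spec2_const a b c d : spec2 a b c d%:P = spec1 a b d.
Proof. by rewrite /spec2 /= map_polyC; apply: hornerC. Qed.

Lemma spec0X a : spec0 a 'X = tau q a.
Proof. exact: hornerX. Qed.

Lemma spec1X a b : spec1 a b 'X = tau q b.
Proof. by rewrite /spec1 /= map_polyX; apply: hornerX. Qed.

Lemma spec2X a b c : spec2 a b c 'X = tau q c.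
Proof. by rewrite /spec2 /= map_polyX; apply: hornerX. Qed.

Lemma spec1_iota a b c : spec1 a b (iota1 c) = idF c.
Proof. by rewrite spec1_const spec0_const. Qed.

Lemma spec2_iota a b c d : spec2 a b c (iota2 d) = idF d.
Proof. by rewrite spec2_const spec1_iota. Qed.

Definition near (n a b : nat) : bool := (b <= a + n)%N && (a <= b + n)%N.

(** For n <= a these are the eigenvalues at most n steps away from tau_a; for
    a < n the truncated subtraction makes the list start at tau_0. *)
Definition nodes (n a : nat) : seq F := [seq tau q b | b <- iota (a - n) (n + n.+1)].

Lemma nodes_uniq n a : uniq (nodes n a).
Proof. by rewrite map_inj_uniq ?iota_uniq //; apply: tau_inj. Qed.

Lemma nodesP n a t : (n <= a)%N -> t \in nodes n a ->
  exists2 b, near n a b & t = tau q b.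
Proof.
move=> na /mapP[b]; rewrite mem_iota => ib ->; exists b => //.
by rewrite /near; lia.
Qed.

Lemma spec0_eq0 N (p : K0) : (forall a, (N <= a)%N -> spec0 a p = 0) -> p = 0.
Proof.
move=> p0; apply/eqP; apply: contraTT isT => p_neq0.
have : all (root p) [seq tau q a | a <- iota N (size p)].
  apply/allP => _ /mapP[a + ->]; rewrite mem_iota => /andP[Na _].
  by rewrite /root; have := p0 a Na; rewrite /spec0 /= /horner_eval => ->.
move=> /(max_poly_roots p_neq0); rewrite map_inj_uniq ?iota_uniq; last first.
  exact: tau_inj.
by move=> /(_ isT); rewrite size_map size_iota ltnn.
Qed.

Variables (n k : nat).
Hypotheses (levelX : level q A n X) (levelY : level q A k Y).

(** The restriction to large [a] keeps the neighbouring indices nonnegative, so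
    that each tau_a has its full set of 2n + 1 distinct neighbours; infinitely
    many values of [a] still separate polynomials in the first variable. *)
Lemma eval1_vanishing N (p : K1) : (n <= N)%N ->
  (forall a b, (N <= a)%N -> near n a b -> spec1 a b p = 0) -> eval1 p = 0.
Proof.
move=> nN p0; pose P : K1 := bad_prod_sym q iota1 'X%:P 'X n.+1.
have [Pl Ps] := bad_prod_sym_lead iota0 'X q_neq0 q_nroot n.
have [h hE] : exists h, forall i, (p - h * P)`_i = 0.
  apply: (@modp_vanishing _ F nat (fun a => N <= a)%N spec0 (nodes n)
            (fun c => c = 0)) => //.
  - exact: spec0_eq0.
  - move=> a _; split; first exact: nodes_uniq.
    by apply: leq_trans Ps _; rewrite size_map size_iota; lia.
  - move=> a _ Na /(nodesP (leq_trans nN Na))[b /andP[ab ba] ->].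
    rewrite -[LHS]/(spec1 a b P) (bad_prod_sym_morph q _ _ (spec1_iota a b)).
    by rewrite spec1_const spec0X spec1X bad_prod_sym_tau.
  - move=> a _ Na /(nodesP (leq_trans nN Na))[b ab ->].
    by rewrite -[LHS]/(spec1 a b p) p0.
have /eqP : p - h * P = 0 by apply/polyP => i; rewrite hE coef0.
rewrite subr_eq0 => /eqP ->; apply: append_rel0 => c.
by rewrite (append_bad_prod _ eval0Z eval0_right) levelX.
Qed.

(** Division by the level polynomial of [Y] leaves coefficients that vanish on the
    pairs (tau_a, tau_b), and these are annihilated by [eval1_vanishing]. *)
Lemma eval2_vanishing (p : K2) :
  (forall a b c, near n a b -> near k b c -> spec2 a b c p = 0) -> eval2 p = 0.
Proof.
move=> p0; pose P : K2 := bad_prod_sym q iota2 'X%:P 'X k.+1.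
have [Pl Ps] := bad_prod_sym_lead iota1 'X q_neq0 q_nroot k.
pose D (s : nat * nat) := (n + k <= s.1)%N && near n s.1 s.2.
have Dk s : D s -> (k <= s.2)%N by rewrite /D /near; lia.
have [h hE] : exists h, forall i, eval1 (p - h * P)`_i = 0.
  apply: (@modp_vanishing _ F _ D (fun s => spec1 s.1 s.2)
            (fun s => nodes k s.2) (fun c => eval1 c = 0)) => //.
  - move=> c c0; apply: (@eval1_vanishing (n + k)); first exact: leq_addr.
    by move=> a b Na ab; apply: (c0 (a, b)); rewrite /D Na.
  - move=> s _; split; first exact: nodes_uniq.
    by apply: leq_trans Ps _; rewrite size_map size_iota; lia.
  - move=> [a b] _ /Dk bk /(nodesP bk)[c /andP[/= bc cb] ->].
    rewrite -[LHS]/(spec2 a b c P) (bad_prod_sym_morph q _ _ (spec2_iota a b c)).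
    by rewrite spec2_const spec1X spec2X bad_prod_sym_tau.
  - move=> [a b] _ Ds /(nodesP (Dk _ Ds))[c bc ->].
    by rewrite -[LHS]/(spec2 a b c p) p0 //; case/andP: Ds.
have : eval2 (p - h * P) = 0 by apply: append_coef0.
rewrite raddfB => /eqP; rewrite subr_eq0 => /eqP ->; apply: append_rel0 => c.
by rewrite (append_bad_prod _ eval1Z eval1_right) levelY.
Qed.

(** |a - b| <= n and |b - c| <= k give |a - c| <= n + k, where the level
    polynomial of the product vanishes. *)
Lemma levelM : level q A (n + k) (X * Y).
Proof.
rewrite /level -eval2_bad_prod; apply: eval2_vanishing => a b c.
move=> /andP[ab ba] /andP[bc cb].
rewrite (bad_prod_sym_morph q _ _ (spec2_iota a b c)).
rewrite spec2_const spec1_const spec0X spec2X bad_prod_sym_tau //; lia.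
Qed.

(** At the eigenvalues this is psi(a)/psi(b) * psi(b)/psi(c) = psi(a)/psi(c) with
    psi(a) = q^(2 a^2). *)
Lemma S_sumM : S_sum q A (X * Y) = S_sum q A X * S_sum q A Y.
Proof.
rewrite (S_sumE levelM) (S_sumE levelX) (S_sumE levelY) -eval2_S_sum.
have -> : \sum_(r < n.+1) S_term q A r X
    = eval1 (S_sym_sum q iota1 'X%:P 'X n).
  rewrite -[S_sym_sum _ _ _ _ _]mul1r.
  by rewrite (append_S_sum _ eval0Z eval0_right) eval0_1 mul1r.
rewrite -(append_S_sum _ eval1Z eval1_right).
apply/eqP; rewrite -subr_eq0 -raddfB; apply/eqP.
apply: eval2_vanishing => a b c /andP[ab ba] /andP[bc cb].
rewrite rmorphB rmorphM spec2_const.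
rewrite !(S_sym_sum_morph q _ _ (spec2_iota a b c)).
rewrite (S_sym_sum_morph q _ _ (spec1_iota a b)) !spec2_const !spec1_const.
rewrite spec0X spec1X spec2X !S_sym_sum_tau //; try lia.
by rewrite mulrACA -mulrA mulVKf ?subrr ?expf_neq0.
Qed.

End Multiplicativity.

(** * Exchanging q and its inverse *)

Section InverseParameter.
Variables (F : fieldType) (q : F) (R : algType F) (A : R).

Lemma not_root_of_unityV : not_root_of_unity q -> not_root_of_unity q^-1.
Proof. by move=> qn n n0; rewrite exprVn invr_eq1 qn. Qed.

Lemma adV r X : ad q^-1 A r X = ad q A (- r) X.
Proof. by rewrite /ad !exprz_inv. Qed.

Lemma badV0 X : bad q^-1 A 0 X = - bad q A 0 X.
Proof. by rewrite /bad adV oppr0 invrK -opprB invrN scaleNr. Qed.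

Lemma badVS n X : bad q^-1 A n.+1 X = bad q A n.+1 X.
Proof.
have powV m : q^-1 ^+ m - q^-1 ^- m = - (q ^+ m - q ^- m).
  by rewrite exprVn invrK opprB.
by rewrite /bad !powV mulrNN sqrrN !adV opprK adC.
Qed.

Lemma bad_prodV n X : bad_prod q^-1 A n.+1 X = - bad_prod q A n.+1 X.
Proof.
elim: n X => [|n IHn] X; first exact: badV0.
transitivity (bad_prod q^-1 A n.+1 (bad q^-1 A n.+1 X)); first by [].
by rewrite badVS IHn.
Qed.

Lemma levelV n X : level q A n X -> level q^-1 A n X.
Proof. by rewrite /level bad_prodV => ->; rewrite oppr0. Qed.

(** Inverting q exchanges ad_n with ad_(-n), fixes the factors bad_n for n > 0
    and changes the signs of bad_0 and of the denominator of the n-th term. *)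
Lemma S'_sumV X : S'_sum q A X = S_sum q^-1 A X.
Proof.
apply: eq_fsbigr => -[//|n] _; rewrite /S'_term /S_term bad_prodV adV scalerN.
by rewrite exprVn invrK -[X in - (X^-1 *: _)]opprB invrN scaleNr opprK.
Qed.

Lemma lusztigBV (B : R) : lusztigB q^-1 A B = lusztig_invB q A B.
Proof.
rewrite /lusztigB /lusztig_invB !invrK exprVn invrK [q^-1 + q]addrC.
by rewrite -(opprB q) -(opprB (q ^+ 2)) mulrNN.
Qed.

End InverseParameter.

(** * Standard elements *)

Section StandardElements.
Variables (F : fieldType) (q : F) (R : algType F) (A : R).

Lemma bad_prodD n X Y :
  bad_prod q A n (X + Y) = bad_prod q A n X + bad_prod q A n Y.
Proof. by elim: n X Y => //= n IHn X Y; rewrite badD IHn. Qed.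

Lemma bad_prodZ n c X : bad_prod q A n (c *: X) = c *: bad_prod q A n X.
Proof. by elim: n X => //= n IHn X; rewrite badZ IHn. Qed.

Lemma level_leq m n X : (m <= n)%N -> level q A m X -> level q A n X.
Proof. by move=> mn; apply: bad_prod_eq0. Qed.

Lemma levelD n X Y : level q A n X -> level q A n Y -> level q A n (X + Y).
Proof. by rewrite /level bad_prodD => -> ->; rewrite addr0. Qed.

Lemma levelZ n c X : level q A n X -> level q A n (c *: X).
Proof. by rewrite /level bad_prodZ => ->; rewrite scaler0. Qed.

Lemma standard_eltP X : standard_elt q A X <-> exists n, level q A n X.
Proof.
by split=> [[[//|n] _ Xn]|[n Xn]]; [exists n|exists n.+1].
Qed.

Lemma level0_comm X : A * X = X * A -> level q A 0 X.
Proof.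
by move=> AX; rewrite /level /= /ad oppr0 !expr0z !scale1r AX subrr scaler0.
Qed.

Lemma S_sum_level0 X : level q A 0 X -> S_sum q A X = X.
Proof. by move=> X0; rewrite (S_sumE X0) big_ord1. Qed.

Lemma S_termD n X Y : S_term q A n (X + Y) = S_term q A n X + S_term q A n Y.
Proof.
by case: n => //= n; rewrite (adD _ _ _ X) (badD _ _ n) bad_prodD scalerDr.
Qed.

Lemma S_termZ n c X : S_term q A n (c *: X) = c *: S_term q A n X.
Proof.
case: n => // n; rewrite /S_term adZ bad_prodZ !scalerA; congr (_ *: _).
exact: mulrC.
Qed.

Lemma S_sumD X Y : standard_elt q A X -> standard_elt q A Y ->
  S_sum q A (X + Y) = S_sum q A X + S_sum q A Y.
Proof.
move=> /standard_eltP[m Xm] /standard_eltP[n Yn].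
have {}Xm := level_leq (leq_maxl m n) Xm.
have {}Yn := level_leq (leq_maxr m n) Yn.
rewrite (S_sumE (levelD Xm Yn)) (S_sumE Xm) (S_sumE Yn) -big_split.
by apply: eq_bigr => r _; rewrite S_termD.
Qed.

Lemma S_sumZ c X : standard_elt q A X -> S_sum q A (c *: X) = c *: S_sum q A X.
Proof.
move=> /standard_eltP[n Xn]; rewrite (S_sumE (levelZ c Xn)) (S_sumE Xn).
by rewrite scaler_sumr; apply: eq_bigr => r _; rewrite S_termZ.
Qed.

End StandardElements.

(** * The q-Onsager algebra *)

Section DolanGrady.
Variables (F : fieldType) (q : F) (R : algType F) (A B : R).
Hypotheses (q_neq0 : q != 0) (q_nroot : not_root_of_unity q).

Lemma ad_ad0 r : ad q A 0 (ad q A r B)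
  = q ^ r *: (A ^+ 2 * B) - (q ^ r + q ^ (- r)) *: (A * B * A)
    + q ^ (- r) *: (B * A ^+ 2).
Proof.
rewrite /ad oppr0 !expr0z !scale1r mulrBr mulrBl -!scalerAr -!scalerAl.
rewrite !expr2 !mulrA scalerDl !opprD !addrA opprK; congr (_ + _).
by rewrite addrAC.
Qed.

Lemma lusztigBE : level q A 1 B -> S_sum q A B = lusztigB q A B.
Proof.
move=> B1; rewrite (S_sumE B1) 2!big_ord_recl big_ord0 addr0 /lusztigB.
congr (_ + _); rewrite /= scalerA ad_ad0 -invfM mulrC.
by rewrite exprN1 expr1z.
Qed.

(** Since bad_0 and bad_1 are multiples of ad_0 and of
    (q^2 - q^-2)^2 I + ad_1 ad_(-1), the relation says that their product
    kills [B]. *)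
Lemma level_dolan_grady :
  A ^+ 3 * B - qnum q 3 *: (A ^+ 2 * B * A)
    + qnum q 3 *: (A * B * A ^+ 2) - B * A ^+ 3
    = (q ^+ 2 - q ^- 2) ^+ 2 *: (B * A - A * B) -> level q A 1 B.
Proof.
move=> dg; have q3E : qnum q 3 = q ^+ 2 + 1 + q ^- 2.
  have := qpowB_neq0 q_neq0 q_nroot (m := 1) isT; rewrite expr1 /qnum => qB.
  have qq : q * q - 1 != 0 by rewrite subr_eq0 -expr2 q_nroot.
  by field; rewrite q_neq0.
have collect (t1 t2 t3 t4 : R) :
    q *: (q^-1 *: t1 - (q^-1 + q) *: t2 + q *: t3)
    - q^-1 *: (q^-1 *: t2 - (q^-1 + q) *: t3 + q *: t4)
    = t1 - qnum q 3 *: t2 + qnum q 3 *: t3 - t4.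
  rewrite !(scalerDr, scalerN) !scalerA mulfV // mulVf // !scale1r.
  rewrite !opprD opprK !addrA [LHS](ACl (1*2*4*3*5*6)) /=.
  rewrite -[_ - _ - _]addrA -opprD -scalerDl -[_ + _ + _ *: t3]addrA -scalerDl.
  have -> : q * (q^-1 + q) + q^-1 * q^-1 = qnum q 3 by rewrite q3E; field.
  by have -> : q * q + q^-1 * (q^-1 + q) = qnum q 3 by rewrite q3E; field.
have cubic : ad q A 1 (ad q A 0 (ad q A (- 1) B))
    = (q ^+ 2 - q ^- 2) ^+ 2 *: (B * A - A * B).
  rewrite -dg -collect ad_ad0 opprK exprN1 expr1z [LHS]/ad exprN1 expr1z.
  rewrite !mulrDr !mulrDl !mulrN !mulNr -!scalerAr -!scalerAl.
  by rewrite !exprS expr0 !mulr1 !mulrA.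
change (bad q A 0 (bad q A 1 B) = 0).
rewrite [bad q A 1 B]/bad badZ badD badZ.
rewrite /bad [ad q A 0 (ad q A 1 _)]adC cubic scalerA [_ * (q - q^-1)^-1]mulrC -scalerA.
by rewrite -!scalerDr {1}/ad oppr0 expr0z !scale1r addrA addrNK subrr !scaler0.
Qed.

End DolanGrady.

Section Generators.
Variables (F : fieldType) (q : F).
Local Notation O := (qOnsager q).
Local Notation A := (oqA q).
Local Notation B := (oqB q).

Lemma qOnsager_ind (P : O -> Prop) : P A -> P B -> P 1 ->
  (forall x y, P x -> P y -> P (x + y)) ->
  (forall x y, P x -> P y -> P (x * y)) ->
  (forall c x, P x -> P (c *: x)) -> forall x, P x.
Proof.
move=> PA PB P1 PD PM PZ; elim/oq_ind => t; rewrite -oq_eval_class.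
elim: t => //= [|t Pt u Pu|t Pt u Pu|c t Pt]; [|exact: PD|exact: PM|exact: PZ].
by rewrite -(scale0r 1); apply: PZ.
Qed.

Variable p : F.
Hypotheses (p_neq0 : p != 0) (p_nroot : not_root_of_unity p).
Hypothesis levelB : level p A 1 B.

Lemma standard_qOnsager : standard_alg p A.
Proof.
apply: qOnsager_ind => [|||x y|x y|c x].
- by apply/standard_eltP; exists 0%N; apply: level0_comm.
- by apply/standard_eltP; exists 1%N.
- by apply/standard_eltP; exists 0%N; apply: level0_comm; rewrite mulr1 mul1r.
- move=> /standard_eltP[m xm] /standard_eltP[n yn]; apply/standard_eltP.
  exists (maxn m n); apply: levelD.
    exact: level_leq (leq_maxl m n) xm.
  exact: level_leq (leq_maxr m n) yn.
- move=> /standard_eltP[m xm] /standard_eltP[n yn]; apply/standard_eltP.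
  by exists (m + n)%N; apply: levelM.
- move=> /standard_eltP[m xm]; apply/standard_eltP.
  by exists m; apply: levelZ.
Qed.

Lemma S_sum_qOnsagerA : S_sum p A A = A.
Proof. by apply/S_sum_level0/level0_comm. Qed.

Lemma S_sum_qOnsager1 : S_sum p A 1 = 1.
Proof. by apply/S_sum_level0/level0_comm; rewrite mulr1 mul1r. Qed.

Lemma S_sum_qOnsagerM (x y : O) :
  S_sum p A (x * y) = S_sum p A x * S_sum p A y.
Proof.
have /standard_eltP[m xm] := standard_qOnsager x.
have /standard_eltP[n yn] := standard_qOnsager y.
exact: S_sumM xm yn.
Qed.

(** Taking [L] or [M] to be the identity compares [S] with an endomorphism, or
    shows that [S] is a section of one. *)
Lemma S_sum_comp (L M : {lrmorphism O -> O}) :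
  L A = M A -> L (S_sum p A B) = M B -> forall x, L (S_sum p A x) = M x.
Proof.
move=> LA LB; apply: qOnsager_ind => [|||x y ex ey|x y ex ey|c x ex].
- by rewrite S_sum_qOnsagerA.
- exact: LB.
- by rewrite S_sum_qOnsager1 !rmorph1.
- rewrite (S_sumD (standard_qOnsager x) (standard_qOnsager y)).
  by rewrite [LHS]raddfD [RHS]raddfD; congr (_ + _).
- by rewrite S_sum_qOnsagerM [LHS]rmorphM [RHS]rmorphM; congr (_ * _).
- by rewrite (S_sumZ c (standard_qOnsager x)) [LHS]linearZ [RHS]linearZ;
     congr (_ *: _).
Qed.

End Generators.

Unset Implicit Arguments.

Theorem proposition5p5 (F : fieldType) (q : F)
    (q_neq0 : q != 0) (q_nroot : not_root_of_unity q) :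
  let A := oqA q in
  let B := oqB q in
  let S := S_sum q A in
  let S' := S'_sum q A in
  [/\ level q A 0 A /\ level q A 1 B,
      standard_alg q A,
      (S A = A /\ S B = lusztigB q A B) /\
      (S' A = A /\ S' B = lusztig_invB q A B)
    & forall (L : {lrmorphism qOnsager q -> qOnsager q})
             (Linv : qOnsager q -> qOnsager q),
        is_lusztig L Linv -> S =1 L /\ S' =1 Linv].
Proof.
move=> A B S S'.
have [rel1 _] := oqP q.
have levelB : level q A 1 B := level_dolan_grady q_neq0 q_nroot rel1.
have levelBV := levelV levelB.
have qV_neq0 : q^-1 != 0 by rewrite invr_eq0.
have qV_nroot := not_root_of_unityV q_nroot.
have S'E x : S' x = S_sum q^-1 A x := S'_sumV q A x.
have SB : S B = lusztigB q A B by apply: lusztigBE.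
have S'B : S' B = lusztig_invB q A B by rewrite S'E lusztigBE // lusztigBV.
split.
- by split=> //; apply: level0_comm.
- exact: standard_qOnsager.
- by rewrite SB S'B S'E /S !S_sum_qOnsagerA.
move=> L Linv [LK LinvK [LA LB] [LinvA LinvB]]; split=> x.
  by apply: (@S_sum_comp _ _ _ _ _ _ idfun L) => //; rewrite ?LA ?LB.
(* Proving that L S' is the identity only uses the morphism laws of L. *)
apply: (can_inj LK); rewrite S'E LinvK.
apply: (@S_sum_comp _ _ _ _ _ _ L idfun) => //.
by rewrite -S'E S'B -LinvB LinvK.
Qed.
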